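(* For every integer $k \geq 2$, $\mathrm{sa}(Q_{2^k+1}) = 2^{k-1}+2$.
   Context: $Q_n$ denotes the $n$-dimensional hypercube: the graph whose vertices are all binary vectors of length $n$, two vertices being adjacent if and only if they differ in exactly one coordinate. A star is a complete bipartite graph $K_{1,m}$ with $m\ge 1$. A galaxy (star forest) is a union of vertex-disjoint stars. The star arboricity $\mathrm{sa}(G)$ of a finite simple graph $G$ is the minimum number of galaxies (subgraphs of $G$) whose edge sets partition the edge set of $G$. *)

(* Defs.v *)
From HB Require Import structures.
From mathcomp Require Import all_boot.
Set Implicit Arguments.
Unset Strict Implicit.
Unset Printing Implicit Defensive.

Record sgraph := SGraph {
  vertex :> finType;
  adj : rel vertex;
  adj_sym : symmetric adj;
  adj_irr : irreflexive adj }.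

Definition edges (G : sgraph) : {set {set G}} :=
  [set [set p.1; p.2] | p : G * G & adj p.1 p.2].

(* A star K_{1,m} on vertices in T is represented by the pair (c, L) of its
   centre c and its set L of m leaves; star_wf expresses m >= 1 and c \notin L.
   The star K_{1,1} thus has two representations. *)
Section Stars.
Variable T : finType.
Implicit Types (s t : T * {set T}) (F : {set {set T}}).

Definition star_wf s := (s.2 != set0) && (s.1 \notin s.2).

Definition star_vertices s : {set T} := s.1 |: s.2.

Definition star_edges s : {set {set T}} := [set [set s.1; l] | l in s.2].

(* Stars have no isolated vertices, so a galaxy is determined by its edges. *)
Definition galaxy F :=
  [exists S : {set T * {set T}},
    [&& [forall s in S, star_wf s],
        [forall s in S, forall t in S,
           (s != t) ==> [disjoint star_vertices s & star_vertices t]]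
      & F == \bigcup_(s in S) star_edges s]].

End Stars.

(* The blocks of a partition are nonempty; allowing galaxies without edges
   would not change the minimal number of galaxies. *)
Definition galaxy_partition (G : sgraph) (D : {set {set {set G}}}) :=
  partition D (edges G) && [forall F in D, galaxy F].

Definition has_galaxy_partition (G : sgraph) (m : nat) :=
  [exists D : {set {set {set G}}}, galaxy_partition D && (#|D| == m)].

Lemma galaxy_edge (T : finType) (x y : T) : x != y -> galaxy [set [set x; y]].
Proof.
move=> xy; apply/existsP; exists [set (x, [set y])]; apply/and3P; split.
- apply/forall_inP => s /set1P->; rewrite /star_wf /= in_set1 xy andbT.
  by apply/set0Pn; exists y; rewrite in_set1.
- by apply/forall_inP => s /set1P->; apply/forall_inP => t /set1P->; rewrite eqxx.
- by rewrite big_set1 /star_edges /= imset_set1.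
Qed.

Lemma ex_galaxy_partition (G : sgraph) : exists m, has_galaxy_partition G m.
Proof.
pose D : {set {set {set G}}} := [set [set e] | e in edges G].
exists #|D|; apply/existsP; exists D; rewrite eqxx andbT.
apply/andP; split; last first.
  apply/forall_inP => F /imsetP[e /imsetP[[x y]]]; rewrite inE /= => xy -> ->.
  by apply: galaxy_edge; apply: contraTneq xy => ->; rewrite adj_irr.
apply/and3P; split.
- apply/eqP/setP => e; apply/bigcupP/idP => [[F /imsetP[f fE ->]] /set1P->//|eE].
  by exists [set e]; rewrite ?set11 //; apply: imset_f.
- apply/trivIsetP => A B /imsetP[e _ ->] /imsetP[f _ ->] ef.
  by rewrite disjoints1 in_set1; apply: contra ef => /eqP->.
- by apply/imsetP => -[e _ /setP/(_ e)]; rewrite in_set0 set11.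
Qed.

Definition star_arboricity (G : sgraph) : nat := ex_minn (ex_galaxy_partition G).

Section Hypercube.
Variable n : nat.

Definition cube_adj (x y : n.-tuple bool) :=
  #|[set i : 'I_n | tnth x i != tnth y i]| == 1.

Lemma cube_adj_sym : symmetric cube_adj.
Proof.
move=> x y; rewrite /cube_adj; congr (_ == 1); apply: eq_card => i.
by rewrite !inE eq_sym.
Qed.

Lemma cube_adj_irr : irreflexive cube_adj.
Proof.
move=> x; rewrite /cube_adj (_ : [set _ | _] = set0) ?cards0 //.
by apply/setP => i; rewrite !inE eqxx.
Qed.

Definition hypercube : sgraph := SGraph cube_adj_sym cube_adj_irr.

End Hypercube.

(* Main.v *)
Require Import Defs.
From mathcomp Require Import all_boot.
From mathcomp Require Import ssralg.

Set Implicit Arguments.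
Unset Strict Implicit.
Unset Printing Implicit Defensive.

Import GRing.Theory.

(** Orient every edge of a galaxy from its leaf to the centre of its star: a
    vertex then has at most one outgoing edge in each galaxy, and none in a
    galaxy where it has an incoming one.

    Lower bound ([regular_galaxy_partition]).  In a d-regular graph cut into
    r < d galaxies no vertex is a leaf of all of them, since a leaf of a galaxy
    has degree one in it.  Hence every vertex has at most r - 1 outgoing edges,
    and counting edges by their leaves gives d / 2 <= r - 1.  For
    d = 2 ^ k + 1, which is odd, this forces r >= 2 ^ (k - 1) + 2.

    Upper bound ([star_arboricity_hypercube_le]).  Put q = k - 2 and let A be
    the group (Z/2)^q.  The 4 * 2 ^ q + 1 coordinates of the cube are named
    (a, b, c), with a in A and b, c bits, together with one extra coordinate *.
    Every vertex x carries four additive invariants: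
    - block x in A, the sum of the a over the coordinates (a, b, c) where x is 1;
    - low x, the parity of x on the two coordinates (0, false, _) and on *;
    - high x, the parity of x on the two coordinates (0, true, _) and on *;
    - side x, the parity of x on the coordinates (a, false, _).
    The directions (a, b, false) and (a, b, true) cut the cube into 4-cycles,
    and each 4-cycle is oriented cyclically; a *-edge is oriented from high = 1
    to high = 0.  There are two kinds of galaxies: the main ones, indexed by
    A x {0,1}, and two special ones.  The edge v -> w joins the main galaxy
    (block w, side w + high w), except when it is local (its direction is * or
    has a = 0) and high w = 0: it then joins the special galaxy low w.  Thus the
    galaxy is read off the centre w.  This uses 2 * 2 ^ q + 2 galaxies, and it
    remains to see that the edges of each colour form stars.

    No vertex is both a leaf and a centre in one galaxy
    ([head_colour_neq]): following an arc changes the block if a <> 0;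
    a local arc into high = 1 changes side + high; a local arc from high = 0
    into high = 0 changes low.  No vertex is a leaf of two stars of one galaxy
    ([head_colour_inj]): by the cyclic orientation exactly one arc leaves v
    along each pair (a, b); for a <> 0 the block of its head determines a and
    the side of its head determines b; among the local arcs, if high v = 0, the
    pair (0, true) leads to a main galaxy and the pair (0, false) to a special
    one, and if high v = 1 the pair (0, false) leads to a main galaxy while the
    pair (0, true) and * lead to the two special ones. *)

(** * Counting edges by leaves *)

(** The set L consists of the leaves of the stars, each of which determines
    its edge. *)
Lemma galaxy_leaves (T : finType) (F : {set {set T}}) : galaxy F ->
  exists2 L : {set T}, #|F| <= #|L| &
    forall v, v \in L -> #|[set e in F | v \in e]| <= 1.
Proof.
case/existsP=> S /and3P[/forall_inP wfS /forall_inP disjS /eqP->].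
have uniqS s t v : s \in S -> t \in S ->
    v \in star_vertices s -> v \in star_vertices t -> s = t.
  move=> sS tS vs vt; apply/eqP; apply: contraTT vt => st.
  have /forall_inP/(_ t tS) := disjS s sS; rewrite st /=.
  by move/disjointFr => ->.
set F0 := \bigcup_(s in S) _.
have leafE s v e : s \in S -> v \in s.2 -> e \in F0 -> v \in e ->
    e = [set s.1; v].
  move=> sS vs /bigcupP[t tS /imsetP[l lt ->]] vtl.
  have st : t = s.
    apply: (uniqS t s v) => //; last exact: setU1r.
    by case/set2P: vtl => ->; [apply: setU11 | apply: setU1r].
  case/set2P: vtl => [v_ctr | -> //]; last by rewrite st.
  by have /andP[_] := wfS s sS; rewrite -st -v_ctr st vs.
pose edge_at v := odflt set0 [pick e in F0 | v \in e].
exists (\bigcup_(s in S) s.2).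
  apply: leq_trans (leq_imset_card edge_at _); apply/subset_leq_card/subsetP.
  move=> e eF; have /bigcupP[s sS /imsetP[l ls eE]] := eF.
  apply/imsetP; exists l; first by apply/bigcupP; exists s.
  rewrite /edge_at; case: pickP => [e' /andP[e'F le']|/(_ e)] /=.
    by rewrite (leafE s l e') // -eE.
  by rewrite eF eE set22.
move=> v /bigcupP[s sS vs]; rewrite -(cards1 [set s.1; v]).
apply/subset_leq_card/subsetP => e; rewrite !inE => /andP[eF ve].
by rewrite (leafE s v e).
Qed.

Lemma card_edges_at (G : sgraph) (v : G) :
  #|[set e in edges G | v \in e]| = #|[set w | adj v w]|.
Proof.
have inj : {in [set w | adj v w] &, injective (fun w => [set v; w])}.
  move=> w w' _; rewrite inE => vw' /setP/(_ w'); rewrite !inE eqxx orbT.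
  by case/orP=> /eqP // vE; rewrite vE adj_irr in vw'.
rewrite -(card_in_imset inj); apply: eq_card => e.
rewrite inE; apply/andP/imsetP => [[/imsetP[[x y]]] | [w]]; rewrite inE /=.
  move=> xy -> /set2P[] ->; first by exists y; rewrite ?inE.
  by exists x; rewrite 1?setUC // inE adj_sym.
move=> vw ->; rewrite set21; split=> //.
by apply/imsetP; exists (v, w); rewrite ?inE.
Qed.

Lemma card_edge (G : sgraph) e : e \in edges G -> #|e| = 2.
Proof.
case/imsetP=> -[x y]; rewrite inE /= => xy ->; rewrite cards2.
by case: eqP xy => // ->; rewrite adj_irr.
Qed.

Lemma handshake (G : sgraph) :
  \sum_(v : G) #|[set w | adj v w]| = #|edges G| * 2.
Proof.
under eq_bigr => v _ do rewrite -card_edges_at -sum1_card.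
rewrite (exchange_big_dep (mem (edges G))) /= => [|v e _]; last first.
  by rewrite inE => /andP[].
rewrite -sum_nat_const; apply: eq_bigr => e eE.
rewrite -(card_edge eE) -sum1_card; apply: eq_bigl => v.
by rewrite inE eE.
Qed.

(** A vertex that is a leaf in all the galaxies would have degree at most
    #|D| < d; so it is a leaf in at most #|D| - 1 of them, whereas the number
    of edges is d / 2 per vertex. *)
Lemma regular_galaxy_partition (G : sgraph) (d : nat)
    (D : {set {set {set G}}}) :
  0 < #|G| -> (forall v : G, #|[set w | adj v w]| = d) ->
  galaxy_partition D -> #|D| < d -> d + 2 <= 2 * #|D|.
Proof.
move=> G0 degG /andP[partD /forall_inP galD] ltDd.
have [L LP] : exists L : {set {set G}} -> {set G}, forall F, F \in D ->
    #|F| <= #|L F| /\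
    forall v, v \in L F -> #|[set e in F | v \in e]| <= 1.
  apply: (@fin_all_exists _ (fun=> {set G}) (fun F LF => F \in D ->
    #|F| <= #|LF| /\ forall v, v \in LF -> #|[set e in F | v \in e]| <= 1)) => F.
  have [/galD/galaxy_leaves[LF]|] := boolP (F \in D); last by exists set0.
  by exists LF.
have leaves_v (v : G) : #|[set F in D | v \in L F]| < #|D|.
  rewrite ltnNge; apply: contraL ltDd => leD; rewrite -leqNgt.
  have /eqP allD : [set F in D | v \in L F] == D.
    rewrite eqEcard leD andbT; apply/subsetP => F.
    by rewrite inE => /andP[].
  rewrite -(degG v) -card_edges_at -sum1_card.
  under eq_bigl do rewrite inE.
  rewrite big_mkcondr /= -(cover_partition partD).
  rewrite (big_trivIset _ (partition_trivIset partD)) /= -[leqRHS]sum1_card.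
  apply: leq_sum => F FD; have [_ /(_ v)] := LP F FD.
  rewrite -big_mkcondr /= sum1dep_card; apply.
  by have := FD; rewrite -{1}allD inE => /andP[].
have leE : #|edges G| <= #|G| * #|D|.-1.
  rewrite (card_partition partD).
  apply: (@leq_trans (\sum_(F in D) #|L F|)).
    by apply: leq_sum => F /LP[].
  under eq_bigr do rewrite -sum1_card.
  rewrite (exchange_big_dep predT) //= -sum_nat_const.
  apply: leq_sum => v _; rewrite sum1dep_card -ltnS prednK ?leaves_v //.
  exact: leq_ltn_trans (leaves_v v).
have := handshake G; under eq_bigr => v _ do rewrite degG.
rewrite sum_nat_const => hs.
have : #|G| * d <= #|G| * (#|D|.-1 * 2) by rewrite hs mulnA leq_mul2r leE orbT.
rewrite leq_pmul2l // => led.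
have /prednK <- : 0 < #|D|.
  by case/card_gt0P: G0 => v _; apply: leq_ltn_trans (leaves_v v).
by rewrite mulnC mulSn addnC leq_add2l.
Qed.

(** * Galaxies from an oriented edge colouring *)

Section Arcs.
Variables (G : sgraph) (C : finType) (arc : C -> rel G).
Hypothesis adj_arc : forall x y,
  reflect (exists c, arc c x y || arc c y x) (adj x y).
Hypothesis arc_colour : forall c c' x y, arc c x y -> arc c' x y -> c = c'.
Hypothesis arc_asym : forall c c' x y, arc c x y -> ~~ arc c' y x.
Hypothesis arc_fun : forall c x y z, arc c x y -> arc c x z -> y = z.
Hypothesis arc_sink : forall c x y z, arc c x y -> ~~ arc c y z.

Let leaves c y := [set x | arc c x y].
Let class c : {set {set G}} := [set [set p.1; p.2] | p : G * G & arc c p.1 p.2].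

Let arc_irr c x : ~~ arc c x x.
Proof. by apply/negP => xx; have := arc_sink x xx; rewrite xx. Qed.

Let class_galaxy c : galaxy (class c).
Proof.
apply/existsP.
exists [set (y, leaves c y) | y in [set y | leaves c y != set0]].
apply/and3P; split.
- apply/forall_inP => _ /imsetP[y yP ->]; rewrite inE in yP.
  by rewrite /star_wf /= yP inE arc_irr.
- apply/forall_inP => _ /imsetP[y yP ->]; apply/forall_inP => _ /imsetP[z zP ->].
  apply/implyP => neq; rewrite -setI_eq0; apply: contraR neq => /set0Pn[v].
  rewrite !inE /= in yP zP *; case/andP=> /orP[/eqP->|vy] /orP[/eqP vz|vz].
  + by rewrite vz.
  + case/set0Pn: yP => u; rewrite inE => uy.
    by have := arc_sink z uy; rewrite vz.
  + case/set0Pn: zP => u; rewrite -vz inE => uv.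
    by have := arc_sink y uv; rewrite vy.
  + by rewrite (arc_fun vy vz).
- apply/eqP/setP => e; apply/imsetP/bigcupP => [[[x y]]|[s]].
    rewrite inE /= => xy ->; exists (y, leaves c y).
      apply/imsetP; exists y => //; rewrite inE.
      by apply/set0Pn; exists x; rewrite inE.
    by apply/imsetP; exists x; rewrite ?inE //= setUC.
  case/imsetP=> y _ -> /imsetP[x]; rewrite inE /= => xy ->.
  by exists (x, y); rewrite ?inE //= setUC.
Qed.

Let class_inj c c' e : e \in class c -> e \in class c' -> c = c'.
Proof.
case/imsetP=> -[x y]; rewrite inE /= => xy -> /imsetP[[z t]]; rewrite inE /= => zt.
move/setP=> E; have /esym := E x; rewrite !inE eqxx /= => /orP[]/eqP xE.
  have := E y; rewrite !inE eqxx orbT -xE => /esym/orP[]/eqP yE.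
    by rewrite yE (negbTE (arc_irr _ _)) in xy.
  by apply: (arc_colour xy); rewrite xE yE.
have := E y; rewrite !inE eqxx orbT -xE => /esym/orP[]/eqP yE.
  by have := arc_asym c' xy; rewrite xE yE zt.
by rewrite yE (negbTE (arc_irr _ _)) in xy.
Qed.

(** The edges of one colour form a galaxy, whose stars consist of the arcs with
    a common head: [arc_fun] makes two stars share no leaf, and [arc_sink]
    keeps a centre from being a leaf. *)
Lemma star_arboricity_arcs : star_arboricity G <= #|C|.
Proof.
(* The colours without edges are dropped, as the blocks of a partition are
   nonempty. *)
pose D := [set class c | c : C] :\ set0.
suff partD : galaxy_partition D.
  rewrite /star_arboricity; case: ex_minnP => m _ /(_ #|D|) minm.
  apply: leq_trans (minm _) _; first by apply/existsP; exists D; rewrite partD /=.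
  by rewrite (leq_trans (subset_leq_card (subsetDl _ _))) ?leq_imset_card.
apply/andP; split; last first.
  by apply/forall_inP => F; rewrite !inE => /andP[_ /imsetP[c _ ->]].
apply/and3P; split.
- apply/eqP/setP => e; apply/bigcupP/imsetP => [[F]|[[x y]]].
    rewrite !inE => /andP[_ /imsetP[c _ ->]] /imsetP[[x y]].
    rewrite inE /= => xy ->; exists (x, y); rewrite // inE.
    by apply/adj_arc; exists c; rewrite xy.
  rewrite inE /= => /adj_arc[c xy] ->.
  have xyc : [set x; y] \in class c.
    apply/imsetP; case/orP: xy => xy; first by exists (x, y); rewrite ?inE.
    by exists (y, x); rewrite 1?setUC ?inE.
  exists (class c) => //.
  by rewrite !inE imset_f // andbT; apply/set0Pn; exists [set x; y].
- apply/trivIsetP => A B; rewrite !inE => /andP[_ /imsetP[c _ ->]].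
  case/andP=> _ /imsetP[c' _ ->]; apply: contraR => /pred0Pn[e /andP[ec ec']].
  by rewrite (class_inj ec ec').
- by rewrite !inE eqxx.
Qed.

End Arcs.

(** * Bit vectors with named coordinates *)

Section Toggle.
Variable I : finType.
Implicit Types (x : {ffun I -> bool}) (i : I).

Definition toggle i x := [ffun j => x j (+) (j == i)].

Lemma toggle_inj x : injective (toggle^~ x).
Proof.
move=> i j /ffunP/(_ i); rewrite !ffunE eqxx => /addbI/esym/eqP; exact.
Qed.

Lemma toggleK i : involutive (toggle i).
Proof. by move=> x; apply/ffunP => j; rewrite !ffunE -addbA addbb addbF. Qed.

(** The syndrome of a binary word x for the parity check matrix whose column
    number i is w i. *)
Definition syndrome (V : zmodType) (w : I -> V) x : V := (\sum_(i | x i) w i)%R.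

Lemma syndrome_toggle (V : zmodType) (w : I -> V) x i :
  (forall v : V, v + v = 0)%R ->
  syndrome w (toggle i x) = (syndrome w x + w i)%R.
Proof.
move=> VV; rewrite /syndrome big_mkcond (bigD1 i) //=.
rewrite [X in (_ = X + _)%R]big_mkcond [X in (_ = X + _)%R](bigD1 i) //=.
rewrite ffunE eqxx addbT [RHS]addrAC; congr (_ + _)%R.
  by case: (x i); rewrite /= ?VV ?add0r.
by apply: eq_bigr => j /negbTE ji; rewrite ffunE ji addbF.
Qed.

Lemma syndrome_toggleb (w : I -> bool) x i :
  syndrome w (toggle i x) = syndrome w x (+) w i.
Proof. by apply: syndrome_toggle; case. Qed.

End Toggle.

Section NamedCoordinates.
Variables (n : nat) (I : finType) (h : I -> 'I_n) (g : 'I_n -> I).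
Hypotheses (hK : cancel h g) (gK : cancel g h).

Definition bits (v : hypercube n) : {ffun I -> bool} := [ffun i => tnth v (h i)].

Definition of_bits (x : {ffun I -> bool}) : hypercube n :=
  [tuple x (g j) | j < n].

Lemma bitsK : cancel bits of_bits.
Proof. by move=> v; apply: eq_from_tnth => j; rewrite tnth_mktuple ffunE gK. Qed.

Lemma of_bitsK : cancel of_bits bits.
Proof. by move=> x; apply/ffunP => i; rewrite ffunE tnth_mktuple hK. Qed.

Lemma adj_bits v w :
  reflect (exists i, bits w = toggle i (bits v)) (adj v w).
Proof.
have tnth_bits u j : tnth u j = bits u (g j) by rewrite ffunE gK.
apply: (iffP cards1P) => [[j diffj]|[i togi]].
  exists (g j); apply/ffunP => i; rewrite !ffunE.
  move/setP/(_ (h i)): diffj; rewrite !inE.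
  by rewrite -(can2_eq hK gK); move: (tnth v _) (tnth w _) (_ == j) => [] [] [].
exists (h i); apply/setP => j; rewrite !inE !tnth_bits togi [toggle _ _ _]ffunE.
rewrite -[in RHS](inj_eq (can_inj gK)) hK.
by move: (bits v _) (_ == i) => [] [].
Qed.

Lemma card_adj_bits (v : hypercube n) : #|[set w | adj v w]| = #|I|.
Proof.
have inj : injective (fun i => of_bits (toggle i (bits v))).
  by move=> i j /(can_inj of_bitsK)/toggle_inj.
rewrite -(card_imset _ inj); apply: eq_card => w.
rewrite inE; apply/adj_bits/imsetP => [[i vw]|[i _ ->]]; exists i => //.
  by rewrite -vw bitsK.
by rewrite of_bitsK.
Qed.

End NamedCoordinates.

Lemma hypercube_regular n (v : hypercube n) : #|[set w | adj v w]| = n.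
Proof. by rewrite (@card_adj_bits n 'I_n id id) ?card_ord. Qed.

(** * The oriented colouring of the cube *)

Section Colouring.
Variable q : nat.

Definition label := {ffun 'I_q -> bool}.

(** [None] is the extra coordinate * of the introduction. *)
Definition coordinate := option (label * bool * bool).

(** [inl] are the main colours and [inr] the two special ones. *)
Definition colour := ((label * bool) + bool)%type.

Implicit Types (x : {ffun coordinate -> bool}) (i j : coordinate).

Definition block i : label := if i is Some (a, _, _) then a else 0%R.
Definition side i := if i is Some (_, b, _) then ~~ b else false.
Definition local i := block i == 0%R.
Definition low i := local i && (if i is Some (_, b, _) then ~~ b else true).
Definition high i := local i && (if i is Some (_, b, _) then b else true).

(** The colour of an arc in direction i with head x. *)
Definition head_colour i x : colour :=
  if local i && ~~ syndrome high x then inr (syndrome low x)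
  else inl (syndrome block x, syndrome side x (+) syndrome high x).

(** Whether the edge at x in direction i is oriented away from x.  For the
    directions (a, b, _), the two coordinates of x run through
    00 -> 10 -> 11 -> 01 -> 00. *)
Definition leaves_via x i :=
  if i is Some (a, b, c) then c == x (Some (a, b, false)) (+) x (Some (a, b, true))
  else syndrome high x.

Let label_addrr (a : label) : (a + a = 0)%R.
Proof. by apply/ffunP => i; rewrite !ffunE; case: (a i). Qed.

Let head_colour_toggle i x : head_colour i (toggle i x) =
  if local i && ~~ (syndrome high x (+) high i)
  then inr (syndrome low x (+) low i)
  else inl (syndrome block x + block i,
            syndrome side x (+) side i (+) (syndrome high x (+) high i))%R.
Proof.
by rewrite /head_colour !syndrome_toggleb (syndrome_toggle _ _ _ label_addrr).
Qed.

Lemma leaves_via_toggle x i : leaves_via (toggle i x) i = ~~ leaves_via x i.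
Proof.
case: i => [[[a b] c]|] /=.
  rewrite !ffunE !(inj_eq Some_inj) !xpair_eqE !eqxx /=.
  by case: c; case: (x _); case: (x _).
by rewrite syndrome_toggleb /high /local eqxx addbT.
Qed.

(** The colour of the head tells the outgoing arcs of a vertex apart.  The
    orientation leaves only one candidate along each pair (a, b), so that
    (a, b) has to be recovered: a is the change of [block]; for a <> 0 the bit
    b is the change of [side] + [high], and for a = 0 it is found from the
    value of [high] at the tail. *)
Lemma head_colour_inj x i j : leaves_via x i -> leaves_via x j ->
  head_colour i (toggle i x) = head_colour j (toggle j x) -> i = j.
Proof.
rewrite !head_colour_toggle.
case: i => [[[a b] c]|]; case: j => [[[a' b'] c']|] //=.
- move=> /eqP-> /eqP->; rewrite /low /high /local /=.
  move: (syndrome low x) (syndrome high x) (syndrome side x) => l u s.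
  move: (syndrome block x) => f E.
  suff [-> -> //] : a = a' /\ b = b'.
  case: (eqVneq a 0%R) E => [->|aN0]; case: (eqVneq a' 0%R) => [->|a'N0] /=.
  + by case: b; case: b'; case: l; case: u; case: s.
  + by case: ifP => // _ [/addrI a'0]; rewrite -a'0 eqxx in a'N0.
  + by case: ifP => // _ [/addrI a0]; rewrite a0 eqxx in aN0.
  + by move=> [/addrI ->]; case: b; case: b'; case: u; case: s.
- (* Here j is *, so that the tail has [high] = 1 and *-arcs are special; the
     only other special local arc has the opposite value of [low]. *)
  move=> _ ->; rewrite /low /high /local /= eqxx /=.
  by case: (eqVneq a 0%R) => //= _; case: b; case: (syndrome low x).
- move=> -> _; rewrite /low /high /local /= eqxx /=.
  by case: (eqVneq a' 0%R) => //= _; case: b'; case: (syndrome low x).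
Qed.

(** A vertex x is a centre at most for its own main colour and, if [high] is 0
    at x, for the special colour given by [low]; the arcs leaving x have other
    colours, because they change the invariant that their colour records. *)
Lemma head_colour_neq x i j : leaves_via x j ->
  head_colour j (toggle j x) != head_colour i x.
Proof.
rewrite head_colour_toggle /head_colour /low /high.
case: j => [[[a b] c]|] /=; rewrite /local /=; last first.
  move=> ->; rewrite eqxx /=; case: ifP => // _.
  by apply/eqP => -[]; case: (syndrome _ _).
move=> _; move: (syndrome low x) (syndrome high x) (syndrome side x) => l u s.
move: (syndrome block x) => f.
case: (eqVneq a 0%R) => [->|aN0] /=; last first.
  case: ifP => // _; apply: contra aN0 => /eqP[/eqP fa _]; move: fa.
  by rewrite -[X in _ == X]addr0 (inj_eq (@addrI _ _)).
rewrite addr0; case: b l u s => [] [] [] []; case: ifP => //;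
  by rewrite ?andbF ?andbT //= => _; apply/eqP => -[].
Qed.

Lemma card_coordinate : #|{: coordinate}| = (2 ^ q * 4).+1.
Proof.
by rewrite card_option !card_prod card_ffun card_bool card_ord -mulnA.
Qed.

Lemma card_colour : #|{: colour}| = 2 ^ q * 2 + 2.
Proof. by rewrite card_sum card_prod card_ffun card_bool card_ord. Qed.

End Colouring.

Lemma star_arboricity_hypercube_le q :
  star_arboricity (hypercube (2 ^ q * 4).+1) <= 2 ^ q * 2 + 2.
Proof.
set n := (2 ^ q * 4).+1; have cI : #|{: coordinate q}| = n := card_coordinate q.
pose h i := cast_ord cI (enum_rank i).
pose g j : coordinate q := enum_val (cast_ord (esym cI) j).
have hK : cancel h g by move=> i; rewrite /g /h cast_ordK enum_rankK.
have gK : cancel g h by move=> j; rewrite /g /h enum_valK cast_ordKV.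
pose b := @bits n _ h.
pose arc c (v w : hypercube n) := [exists i, [&& b w == toggle i (b v),
  leaves_via (b v) i & head_colour i (b w) == c]].
have arcP c v w : arc c v w -> exists i, [/\ b w = toggle i (b v),
    leaves_via (b v) i & head_colour i (b w) = c].
  by case/existsP=> i /and3P[/eqP ? ? /eqP ?]; exists i.
rewrite -card_colour; apply: (@star_arboricity_arcs _ _ arc).
- move=> v w; apply: (iffP (adj_bits hK gK v w)) => [[i vw]|[c]].
    have [go|] := boolP (leaves_via (b v) i).
      exists (head_colour i (b w)); apply/orP; left; apply/existsP; exists i.
      by rewrite /b vw go !eqxx.
    rewrite -leaves_via_toggle -vw => go.
    exists (head_colour i (b v)); apply/orP; right; apply/existsP; exists i.
    by rewrite /b vw toggleK -vw go !eqxx.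
  case/orP=> /arcP[i [vw _ _]]; exists i; rewrite // -[bits h v]/(b v) in vw *.
  by rewrite vw toggleK.
- move=> c c' v w /arcP[i [vw _ <-]] /arcP[i' [vw' _ <-]].
  by rewrite (toggle_inj (etrans (esym vw) vw')).
- move=> c c' v w /arcP[i [vw go _]]; apply/negP => /arcP[i' [wv go' _]].
  have vE : toggle i (b w) = b v by rewrite vw toggleK.
  have ii' := toggle_inj (etrans vE wv).
  by rewrite -ii' vw leaves_via_toggle go in go'.
- move=> c v w u /arcP[i [vw go <-]] /arcP[j [vu go']].
  rewrite vw vu => /(head_colour_inj go' go) ji.
  by apply: (can_inj (bitsK gK)); rewrite -!/(b _) vw vu ji.
- move=> c v w u /arcP[i [vw go <-]]; apply/negP => /arcP[j [wu go']] E.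
  by have /eqP := head_colour_neq i go'; rewrite -wu E.
Qed.

(** * The star arboricity of the cube of dimension 2 ^ k + 1 *)

Theorem theorem2 (k : nat) (hk : 2 <= k) :
  star_arboricity (hypercube (2 ^ k + 1)) = 2 ^ (k - 1) + 2.
Proof.
apply/eqP; rewrite eqn_leq; apply/andP; split.
  have := star_arboricity_hypercube_le (k - 2).
  rewrite -addn1 -(expnD 2 _ 2) subnK // -expnSr.
  by rewrite -subSn // subSS.
rewrite /star_arboricity; case: ex_minnP => r /existsP[D /andP[partD /eqP <-]] _.
have := regular_galaxy_partition _ (@hypercube_regular _) partD.
rewrite card_tuple card_bool expn_gt0 => /(_ isT); move: #|D| => d.
have -> : 2 ^ k = 2 * 2 ^ (k - 1) by rewrite -expnS -subSn ?subn1 // ltnW.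
have: 0 < 2 ^ (k - 1) by rewrite expn_gt0.
move: (2 ^ (k - 1)) => p p_gt0 lb; rewrite leqNgt addn2 ltnS.
apply/negP => ledp; have ltd : d < 2 * p + 1.
  by rewrite addn1 ltnS mul2n -addnn (leq_trans ledp) // -add1n leq_add2r.
have := leq_trans (lb ltd) (leq_mul (leqnn 2) ledp).
by rewrite mulnS addnC leq_add2l addn1 ltnn.
Qed.
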